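(* Let $F$ be a commutative field of characteristic $\neq 2$ and let $\mathcal{E}$ be a nil finite-dimensional evolution algebra over $F$. The following statements are equivalent: 1) $\mathcal{E}$ is a fourth power-associative algebra; 2) $\mathcal{E}$ is a Jordan algebra.
   Context: An $n$-dimensional (not necessarily associative) algebra $\mathcal{E}$ over $F$ is an evolution algebra if it has a basis $\{e_1,\ldots,e_n\}$ (a natural basis) with $e_ie_j=0$ for all $i\neq j$ (and $e_i^2$ arbitrary); such an algebra is commutative. Principal powers are $a^1=a$, $a^{k+1}=a^ka$. An algebra is nil if for every element $a$ there is $n(a)\ge 1$ with $a^{n(a)}=0$. It is fourth power-associative if $x^2x^2=x^4$ for all $x$. It is Jordan if it is commutative and $(x^2y)x=x^2(yx)$ for all $x,y$. *)

(* Defs.v *)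
From HB Require Import structures.
From mathcomp Require Import all_boot all_order all_algebra.

Set Implicit Arguments.
Unset Strict Implicit.
Unset Printing Implicit Defensive.

Import GRing.Theory.
Local Open Scope ring_scope.

(* A finite-dimensional, not necessarily associative or unital, F-algebra is a
   vectType E over F together with a bilinear product mul on E. *)

Section NonassociativeAlgebra.

Variables (F : fieldType) (E : vectType F) (mul : {bilinear E -> E -> E}).

Definition evolution_algebra : Prop :=
  exists2 e : (\dim {:E}).-tuple E,
    basis_of {:E} e
    & forall i j : 'I_(\dim {:E}), i != j -> mul (tnth e i) (tnth e j) = 0.

(* a^1 = a and a^(k+1) = a^k a; the index 0 has no mathematical meaning here
   (there is no unit) and gets the junk value a. *)
Definition principal_power (a : E) (k : nat) : E :=
  iter k.-1 (fun b => mul b a) a.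

Definition nil_algebra : Prop :=
  forall a : E, exists2 k : nat, (1 <= k)%N & principal_power a k = 0.

Definition fourth_power_associative : Prop :=
  forall x : E,
    mul (principal_power x 2) (principal_power x 2) = principal_power x 4.

Definition jordan_algebra : Prop :=
  (forall x y : E, mul x y = mul y x) /\
  (forall x y : E, mul (mul (principal_power x 2) y) x
                   = mul (principal_power x 2) (mul y x)).

End NonassociativeAlgebra.

(* Main.v *)
(** Let [e] be a natural basis, [s_i = e_i^2] and [a_ik] the [e_k]-coordinate
    of [s_i], so that [s_i e_k = a_ik s_k]. If [x^4 = c x^2] with [c <> 0], then
    nilpotency of [x] forces [x^2 = 0]; this gives [a_ii = 0]. Evaluating
    [x^2 x^2 = x^4] at [e_i + e_j] yields [a_ij a_ji = 0] and [s_i s_j = 0], and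
    at [+-e_i + e_j + e_k] it yields [a_ij a_jk s_k + a_ik a_kj s_j = 0], where
    one term vanishes because [a_jk a_kj = 0]. So [(E^2 E)E = 0 = E^2 E^2], and
    both sides of the Jordan identity are zero. Only the scalars 0, 1, -1 are
    used, which is why small fields such as [F_3] are not an exception. *)

Require Import Defs.
From HB Require Import structures.
From mathcomp Require Import all_boot all_order all_algebra.
Import GRing.Theory.
Local Open Scope ring_scope.

Lemma jordan_fourth_power_associative (F : fieldType) (E : vectType F)
    (mul : {bilinear E -> E -> E}) :
  jordan_algebra mul -> fourth_power_associative mul.
Proof. by case=> _ jord x; rewrite -[LHS]jord. Qed.

(** With [R] denoting multiplication by [x], the hypothesis says that [R^2] scales [x^2] by [c].
    Hence [R^(2m)(x^2) = c^m x^2], and nilpotency of [x] kills the left side for large [m]. *)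
Lemma nil_sq_eq0 (F : fieldType) (E : vectType F)
    (mul : {bilinear E -> E -> E}) (x : E) (c : F) :
  nil_algebra mul -> c != 0 -> mul (mul (mul x x) x) x = c *: mul x x ->
  mul x x = 0.
Proof.
move=> nilE c0 x4; have [k _] := nilE x.
rewrite /principal_power; set R := fun b => mul b x; set m := k.-1 => xm0.
have xn0 n : iter (n + m) R x = 0.
  by elim: n => [|n IHn] //=; rewrite IHn /R linear0l.
have x2n n : iter n.*2 R (mul x x) = c ^+ n *: mul x x.
  elim: n => [|n IHn]; first by rewrite expr0 scale1r.
  by rewrite doubleS /= IHn /R !linearZl_LR /= x4 scalerA exprSr.
(* Here [x^(m+1) = R^m(x) = 0], and [R^(2m)(x^2) = R^(2m+1)(x)] lies beyond it. *)
have /eqP : c ^+ m *: mul x x = 0.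
  rewrite -x2n -[mul x x]/(R x) -iterSr -addnn -addSn; exact: xn0.
by rewrite scaler_eq0 expf_eq0 (negPf c0) andbF => /eqP.
Qed.

Lemma eq0_on_basis (F : fieldType) (E : vectType F) (n : nat)
    (e : n.-tuple E) (f : {linear E -> E}) :
  basis_of {:E} e -> (forall i : 'I_n, f e`_i = 0) -> forall x, f x = 0.
Proof.
move=> be f0 x; rewrite (coord_basis be (memvf x)) linear_sum big1 // => i _.
by rewrite linearZ /= f0 scaler0.
Qed.

Section NaturalBasis.

Variables (F : fieldType) (E : vectType F) (mul : {bilinear E -> E -> E}).
Variables (n : nat) (e : n.-tuple E).
Hypothesis be : basis_of {:E} e.
Hypothesis me : forall i j : 'I_n, i != j -> mul e`_i e`_j = 0.

Let s (i : 'I_n) := mul e`_i e`_i.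
Let a (i k : 'I_n) : F := coord e k (s i).

Lemma mul_natural_basis x (k : 'I_n) : mul x e`_k = coord e k x *: s k.
Proof.
rewrite {1}(coord_basis be (memvf x)) linear_sumlz (bigD1 k) //=.
rewrite linearZl_LR big1 ?addr0 // => i ik.
by rewrite linearZl_LR /= me // scaler0.
Qed.

Lemma evolution_mulC x y : mul x y = mul y x.
Proof.
have me_sym (k : 'I_n) z : mul z e`_k = mul e`_k z.
  rewrite (coord_basis be (memvf z)) linear_sumlz linear_sumr.
  apply: eq_bigr => i _; rewrite linearZl_LR linearZr_LR /=.
  by have [->|ik] := eqVneq i k => //; rewrite !me // eq_sym.
rewrite (coord_basis be (memvf y)) linear_sumlz linear_sumr.
by apply: eq_bigr => i _; rewrite linearZl_LR linearZr_LR /= me_sym.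
Qed.

Hypothesis nilE : nil_algebra mul.
Hypothesis fpaE : fourth_power_associative mul.
Hypothesis two_neq0 : 2%:R != 0 :> F.

Let fpa x : mul (mul x x) (mul x x) = mul (mul (mul x x) x) x.
Proof. exact: fpaE. Qed.

Let se (i k : 'I_n) : mul (s i) e`_k = a i k *: s k.
Proof. exact: mul_natural_basis. Qed.

(** At [x = e_i] one has [x^4 = a_ii^2 x^2]. *)
Lemma structure_diag i : a i i = 0.
Proof.
apply/eqP; apply: contraT => aii0.
have s0 : s i = 0.
  apply: (nil_sq_eq0 _ _ _ _ (a i i * a i i) nilE).
    by rewrite mulf_neq0.
  by rewrite -/(s i) se linearZl_LR /= se scalerA.
by move: aii0; rewrite /a s0 linear0 eqxx.
Qed.

Let double_eq0 (v : E) : v + v = 0 -> v = 0.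
Proof.
by move/eqP; rewrite -mulr2n -scaler_nat scaler_eq0 (negPf two_neq0) => /eqP.
Qed.

(** At [x = e_i + e_j], [x^3 = a_ij s_j + a_ji s_i] and [x^4 = c x^2] with [c = a_ij a_ji]. *)
Lemma structure_antisym i j : a i j * a j i = 0.
Proof.
have [->|ij] := eqVneq i j; first by rewrite structure_diag mul0r.
have x2 : mul (e`_i + e`_j) (e`_i + e`_j) = s i + s j.
  rewrite !(linearDl, linearDr) /= (me i j) // (me j i) 1?eq_sym //.
  by rewrite addr0 add0r.
apply/eqP; apply: contraT => c0.
have : s i + s j = 0.
  rewrite -x2; apply: (nil_sq_eq0 _ _ _ _ _ nilE c0); rewrite x2.
  rewrite !(linearDl, linearDr) /= !se !structure_diag !(scale0r, add0r, addr0).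
  rewrite !linearZl_LR /= !se !structure_diag.
  rewrite !(linear0l, scale0r, scaler0, add0r, addr0).
  by rewrite !scalerA scalerDr [a j i * _]mulrC.
(* The [e_j]-coordinate of [s_i + s_j] is [a_ij + a_jj = a_ij], a factor of [c]. *)
move/(congr1 (coord e j)); rewrite linearD linear0 /= -/(a i j) -/(a j j).
rewrite structure_diag addr0 => aij0.
by move: c0; rewrite aij0 mul0r eqxx.
Qed.

(** At [x = e_i + e_j], [structure_antisym] gives [x^4 = 0], while [x^2 x^2 = 2 s_i s_j] once
    [s_i s_i = s_j s_j = 0]. *)
Lemma mul_sq_sq i j : mul (s i) (s j) = 0.
Proof.
have sii (k : 'I_n) : mul (s k) (s k) = 0.
  by rewrite fpa -/(s k) se structure_diag scale0r linear0l.
have [->|ij] := eqVneq i j; first exact: sii.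
have x2 : mul (e`_i + e`_j) (e`_i + e`_j) = s i + s j.
  rewrite !(linearDl, linearDr) /= (me i j) // (me j i) 1?eq_sym //.
  by rewrite addr0 add0r.
have := fpa (e`_i + e`_j); rewrite x2.
rewrite !(linearDl, linearDr) /= !se !structure_diag !(scale0r, add0r, addr0).
rewrite !linearZl_LR /= !se !structure_diag !scalerA !structure_antisym.
rewrite !(linear0l, mulr0, scale0r, scaler0, sii, add0r, addr0).
by rewrite (evolution_mulC (s j)) => /double_eq0.
Qed.

Lemma structure_path i k j : (a i k * a k j) *: s j = 0.
Proof.
have [->|ik] := eqVneq i k; first by rewrite structure_diag mul0r scale0r.
have [->|kj] := eqVneq k j; first by rewrite structure_diag mulr0 scale0r.
have [->|ij] := eqVneq i j; first by rewrite structure_antisym scale0r.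
(* Up to the sign [c] below, [S i k j] is the part of [x^4] obtained from [s_i] by multiplying by
   [e_j] and [e_k] in either order. *)
pose S i k j := (a i k * a k j) *: s j + (a i j * a j k) *: s k.
(* A sign on [e_i] leaves [x^2] unchanged and affects only the terms starting from [s_j] or [s_k],
   which pick up one factor [e_i]. *)
have fpa_sign (c : F) : c * c = 1 -> S i k j + c *: (S j i k + S k i j) = 0.
  move=> cc; have x2 : mul (c *: e`_i + e`_j + e`_k) (c *: e`_i + e`_j + e`_k)
                     = s i + s j + s k.
    rewrite !(linearDl, linearDr, linearZl_LR, linearZr_LR) /= scalerA cc scale1r.
    rewrite (me i j) // (me j i) 1?eq_sym // (me i k) // (me k i) 1?eq_sym //.
    rewrite (me k j) // (me j k) 1?eq_sym //.
    by rewrite !(scaler0, addr0, add0r).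
  have := fpa (c *: e`_i + e`_j + e`_k); rewrite x2.
  rewrite !(linearDl, linearDr, linearZl_LR, linearZr_LR) /= !mul_sq_sq !addr0.
  rewrite !se !structure_diag !(scale0r, scaler0, addr0, add0r).
  rewrite !(linearDl, linearZl_LR) /= !se !structure_diag.
  rewrite !(linear0l, scale0r, scaler0, addr0, add0r) !scalerA -!mulrA.
  rewrite ?structure_antisym ?(mulrCA (a _ _) c) ?structure_antisym.
  rewrite ?(mulr0, scale0r, addr0, add0r) /S.
  move=> h; rewrite [RHS]h !scalerDr !scalerA.
  (* The expansion of [x^4] groups the six terms by their final square, [S] by their initial one. *)
  by rewrite [LHS](AC (2*(2*2)) ((4*6)*(1*5)*(2*3))).
(* Comparing the signs [1] and [-1] gives [S i k j + S i k j = 0]. *)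
have S0 : S i k j = 0.
  have := fpa_sign 1 (mulr1 1); have := fpa_sign (-1).
  rewrite mulrNN mulr1 scaleN1r scale1r => /(_ erefl) /subr0_eq <-.
  exact: double_eq0.
move/eqP: (structure_antisym k j); rewrite mulf_eq0 => /orP[] /eqP z0.
  by rewrite z0 mulr0 scale0r.
by move: S0; rewrite /S z0 mulr0 scale0r addr0.
Qed.

Lemma natural_basis_jordan : jordan_algebra mul.
Proof.
split=> [|x y]; first exact: evolution_mulC.
have mul3 (i : 'I_n) y' z : mul (mul (s i) y') z = 0.
  apply: (eq0_on_basis _ _ _ _ (mul (mul (s i) y')) be) => j /=.
  (* With [e_j] on the left, the product is a composite of linear maps in [y']. *)
  rewrite (evolution_mulC _ e`_j).
  apply: (eq0_on_basis _ _ _ _ (mul e`_j \o mul (s i)) be) => k /=.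
  by rewrite (evolution_mulC e`_j) se linearZl_LR /= se scalerA structure_path.
(* Every product lies in the span of the [s k], so [mul3] kills the left side of the Jordan identity
   and [mul_sq_sq] the right side. *)
have sq_sum u v : mul u v = \sum_k coord e k v *: (coord e k u *: s k).
  rewrite {1}(coord_basis be (memvf v)) linear_sumr; apply: eq_bigr => k _.
  by rewrite linearZr_LR /= mul_natural_basis.
rewrite /principal_power /= (sq_sum x x) !linear_sumlz big1 => [|i _]; last first.
  by rewrite !linearZl_LR /= mul3 !scaler0.
rewrite big1 // => i _; rewrite !linearZl_LR /= (sq_sum y x) linear_sumr.
by rewrite big1 ?scaler0 // => k _; rewrite !linearZr_LR /= mul_sq_sq !scaler0.
Qed.

End NaturalBasis.

Theorem proposition3p4p3 (F : fieldType) (charF : 2%N \notin [pchar F])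
    (E : vectType F) (mul : {bilinear E -> E -> E})
    (evoE : evolution_algebra mul) (nilE : nil_algebra mul) :
  fourth_power_associative mul <-> jordan_algebra mul.
Proof.
split=> [fpaE|]; last exact: jordan_fourth_power_associative.
have [e be me] := evoE.
(* The goal [2%:R != 0] is [charF] up to computation, as [prime 2] evaluates to [true]. *)
apply: (natural_basis_jordan _ _ _ _ e be) => // i j ij.
by rewrite -[RHS](me i j ij) !(tnth_nth 0).
Qed.
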